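(* Let $\{G_n\}_{n\ge 1}$ be a sequence of graphs such that $\mathrm{diam}(G_n)=\omega(1)$ (i.e. $\mathrm{diam}(G_n)\to\infty$ as $n\to\infty$), and let $\{r_n\}_{n\ge 1}$ be a sequence of positive integers such that $r_n=\varepsilon\cdot \mathrm{diam}(G_n)$. Then $$\lambda_2\big(G_n^{(r_n)}\big)\ \ge\ (1-o_\varepsilon(1))\,(r_n+1)\,\hat d_{r_n}(G_n)^{\,r_n/2},$$ where, for a graph $G$ and a positive integer $r$, $$\hat d_r(G)=\left(\frac{1}{r+1}\sum_{i=0}^{r}\sqrt{\delta^{(i)}(G)\,\delta^{(r-i)}(G)}\right)^{2/r},$$ $$\delta^{(i)}(G)=\min_{(x,y)\in E(G)}\big|\{v\in V(G):\ \mathrm{dist}_G(x,v)=i,\ \mathrm{dist}_G(y,v)\ge i\}\big| .$$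
   Context: Graphs are finite and connected (so that the diameter is defined), may be irregular, may have self-loops, and have no repeated edges. $\mathrm{dist}_G$ is the graph distance and $\mathrm{diam}(G)$ the maximum distance between two vertices. For $r\ge 1$, the $r$-th power $G^{(r)}$ is the graph on vertex set $V(G)$ with an edge $\{x,y\}$ iff $\mathrm{dist}_G(x,y)\le r$ (in particular it has a self-loop at every vertex and no repeated edges). $\lambda_1(G)\ge\lambda_2(G)\ge\cdots$ denote the eigenvalues of the adjacency matrix of $G$. The minimum defining $\delta^{(i)}(G)$ is over all ordered pairs $(x,y)$ of adjacent vertices. $o_\varepsilon(1)$ denotes a quantity tending to $0$ as $\varepsilon\to 0$. *)

(* Defs.v *)
From HB Require Import structures.
From mathcomp Require Import all_boot all_order all_algebra.
From mathcomp Require Import polyrcf.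
From mathcomp Require Import all_classical all_reals all_analysis.

Set Implicit Arguments.
Unset Strict Implicit.
Unset Printing Implicit Defensive.

Import Order.TTheory GRing.Theory Num.Theory.
Import numFieldNormedType.Exports.

Local Open Scope ring_scope.

(* Self-loops are allowed, so [adj] is not required to be irreflexive. *)
Record graph := Graph {
  vertex :> finType;
  adj : rel vertex;
  adj_sym : symmetric adj }.

Section Distance.
Variable G : graph.
Implicit Types (x y : G) (k : nat).

Definition connected_graph : Prop := forall x y, connect (@adj G) x y.

Definition has_walk k x y : bool :=
  [exists p : k.-tuple G, path (@adj G) x p && (last x p == y)].

(* In a connected graph the distance is smaller than #|G|, so searching below
   #|G| loses nothing; unreachable pairs get the junk value #|G|. *)
Definition gdist x y : nat := find (fun k => has_walk k x y) (iota 0 #|G|).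

Definition diam : nat := (\max_(x : G) \max_(y : G) gdist x y)%N.

Lemma has_walk_sym k x y : has_walk k x y = has_walk k y x.
Proof.
suff sub a b : has_walk k a b -> has_walk k b a by apply/idP/idP; exact: sub.
case/existsP => p /andP[Hp /eqP <-]; apply/existsP.
have Hs : size (rev (belast a p)) == k by rewrite size_rev size_belast size_tuple.
exists (Tuple Hs) => /=; rewrite rev_path; apply/andP; split.
  by rewrite (eq_path (e' := @adj G)) // => u v; rewrite adj_sym.
by case: {Hp Hs} (tval p) => //= c s; rewrite rev_cons last_rcons.
Qed.

Lemma gdist_sym x y : gdist x y = gdist y x.
Proof. by apply: eq_find => k; rewrite has_walk_sym. Qed.

(* #|G| bounds every term from above, so as the unit of [minn] it does not
   affect the minimum as soon as there is an edge. *)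
Definition delta (i : nat) : nat :=
  (\big[minn/#|G|]_(e : G * G | adj e.1 e.2)
     #|[set v | (gdist e.1 v == i) && (i <= gdist e.2 v)]|)%N.

End Distance.

Definition power_adj (G : graph) (r : nat) : rel G :=
  fun x y => (gdist x y <= r)%N.

Lemma power_adj_sym (G : graph) (r : nat) : symmetric (power_adj (G := G) r).
Proof. by move=> x y; rewrite /power_adj gdist_sym. Qed.

Definition power_graph (G : graph) (r : nat) : graph :=
  Graph (power_adj_sym (G := G) r).

Section Spectrum.
Variable R : realType.

(* A self-loop contributes 1 to the diagonal. *)
Definition adj_matrix (G : graph) : 'M[R]_#|G| :=
  \matrix_(i, j) (adj (enum_val i) (enum_val j))%:R.

(* The real roots of the characteristic polynomial, in nonincreasing order and
   repeated according to multiplicity ([rootsR] is increasing without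
   repetition); for a symmetric matrix of size n these are n values. *)
Definition eigenvalues n (A : 'M[R]_n) : seq R :=
  flatten [seq nseq (mup x (char_poly A)) x | x <- rev (rootsR (char_poly A))].

(* 1-based: [lambda 1 G] is the largest eigenvalue. *)
Definition lambda (k : nat) (G : graph) : R :=
  (eigenvalues (adj_matrix G))`_k.-1.

Definition d_hat (r : nat) (G : graph) : R :=
  ((r.+1)%:R^-1 *
     \sum_(0 <= i < r.+1) Num.sqrt (((delta G i)%:R : R) * (delta G (r - i))%:R))
  `^ (2 / r%:R).

End Spectrum.

(* Main.v *)
Require Import Defs.
From mathcomp Require Import all_boot all_order all_algebra.
From mathcomp Require Import complex polyrcf.
From mathcomp Require Import all_classical all_reals all_analysis.
From mathcomp Require Import ring lra zify.

Import Order.TTheory GRing.Theory Num.Theory.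
Import numFieldNormedType.Exports.

Set Implicit Arguments.
Unset Strict Implicit.
Unset Printing Implicit Defensive.

Local Open Scope ring_scope.

(** Write [D] for the diameter, [t_i := sqrt (delta_i * delta_(r-i))] and
    [S := t_0 + ... + t_r], so that [(r+1) * d_hat^(r/2) = S].  The error term
    is [o(eps) = 8 * eps].  When [8 * r >= D] the left-hand side is nonpositive
    and it suffices that the second eigenvalue is nonnegative, which holds
    because every vertex of the power graph carries a self-loop
    ([lambda2_ge0]).

    Otherwise take two vertices at distance [D] and the balls of radius
    [L = floor ((D - r - 1) / 2)] around them.  No edge of the power graph joins
    the two balls, so by the spectral theorem the second eigenvalue is at least
    the smaller of the top Rayleigh quotients on the two balls
    ([second_eigenvalue_le], [lambda2_two_balls]).  The heart of the matter is
    therefore local: if [c0] bounds the Rayleigh quotients of the functions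
    supported in the ball around [u], then [(n - r) * S <= c0 * n] where
    [n = L - r] ([ball_bound]).  Since [n] is of order [D], this is
    [c0 >= (1 - O(r / D)) * S].

    For the local bound let [c > c0] and let [K] be the adjacency operator of
    the power graph compressed to the ball.  As [c - K] is positive definite and
    [K] is entrywise nonnegative, [g := (c - K)^-1 1] is positive and
    [K g <= c g] ([positive_supersolution]).  Let [f(h)] be the minimum of [g]
    over the ends of the walks of length [h] issued from [u].  Given such a walk
    to the minimiser [v], remove its last [r - i] steps, let [x] be its new end
    and [y] the vertex before [x], and continue to any vertex at distance [i]
    from [x] and at least [i] from [y].  At least [delta_i] vertices are reached
    in this way, all of them are neighbours of [v] in the power graph and ends
    of walks of length [h - r + 2i], and different [i] reach different vertices
    ([branch_index_unique]).  Summing [g] over them,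

      [sum_i delta_i * f(h - r + 2i) <= c * f(h)]

    as long as the lengths stay in a window of [n] integers.  Divide by [f(h)]
    and sum over the window: the jump [(h, i)] from [h] to [h' = h - r + 2i] and
    its reverse [(h', r - i)] together contribute at least [2 * t_i] by the
    inequality between arithmetic and geometric means, and every [i] is the type
    of at least [n - r] jumps inside the window ([toeplitz_supersolution]). *)

(** * Eigenvalues of real symmetric matrices *)

Lemma mup_prod_XsubC (F : fieldType) (x : F) (s : seq F) :
  mup x (\prod_(a <- s) ('X - a%:P)) = count_mem x s.
Proof.
elim: s => [|a s IH]; first by rewrite big_nil mupNroot // root1.
have nz : \prod_(b <- s) ('X - b%:P) != 0 by rewrite monic_neq0 // monic_prod_XsubC.
rewrite big_cons mupM ?polyXsubC_eq0 // IH /=.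
by rewrite -['X - _]expr1 mup_XsubCX; case: eqP.
Qed.

Section Spectral.
Variable R : realType.
Local Notation C := R[i].
Local Notation toC := (@real_complex_def R (Phant R)).

Lemma count_mem_flatten_nseq (T : eqType) (m : T -> nat) (x : T) (s : seq T) :
  uniq s ->
  count_mem x (flatten [seq nseq (m y) y | y <- s]) = ((x \in s) * m x)%N.
Proof.
elim: s => //= y s IH /andP[ys us]; rewrite count_cat count_nseq /= IH // inE.
have [->|ne] := eqVneq x y; last by rewrite mul0n.
by rewrite (negPf ys) mul0n addn0.
Qed.

Lemma perm_eigenvalues n (A : 'M[R]_n) (s : seq R) :
  char_poly A = \prod_(a <- s) ('X - a%:P) -> perm_eq (eigenvalues A) s.
Proof.
move=> Ep; apply/allP => x _ /=; apply/eqP.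
have nz : char_poly A != 0 by rewrite Ep monic_neq0 // monic_prod_XsubC.
rewrite /eigenvalues count_mem_flatten_nseq; last first.
  by rewrite rev_uniq (sorted_uniq lt_trans ltxx) // sorted_roots.
rewrite mem_rev -(roots_on_rootsR nz) in_itv /= -mup_prod_XsubC -Ep.
by have [_|/mupNroot->] := boolP (root _ x); rewrite ?mul1n.
Qed.

Lemma sorted_eigenvalues n (A : 'M[R]_n) : sorted >=%R (eigenvalues A).
Proof.
rewrite /eigenvalues; set m := fun x : R => mup x (char_poly A).
have: sorted >%R (rev (rootsR (char_poly A))) by rewrite rev_sorted sorted_roots.
elim: (rev _) => //= x s IH; rewrite (path_sortedE (rev_trans lt_trans)) => /andP[/allP lt_s ss].
rewrite (sorted_pairwise (rev_trans le_trans)) pairwise_cat.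
rewrite -!(sorted_pairwise (rev_trans le_trans)) IH // andbT.
apply/andP; split; last first.
  suff sn k : sorted >=%R (nseq k x) by exact: sn.
  by elim: k => // -[|k] //= ->; rewrite lexx.
apply/allrelP => y z; rewrite mem_nseq => /andP[_ /eqP->].
case/flatten_mapP => w ws; rewrite mem_nseq => /andP[_ /eqP->].
exact/ltW/lt_s.
Qed.

Lemma count_gt_second (s : seq R) : sorted >=%R s ->
  (count (fun x => (s`_1 < x)%R) s <= 1)%N.
Proof.
case: s => [|a [|b s]] //=; first by rewrite addn0 leq_b1.
rewrite (path_sortedE (rev_trans le_trans)) => /and3P[_ /allP ge_b _].
rewrite ltxx add0n (eq_in_count (a2 := pred0)) ?count_pred0 ?addn0 ?leq_b1 //.
by move=> x /ge_b /= xb; rewrite ltNge xb.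
Qed.

Lemma conjC_toC (x : R) : Num.conj (toC x) = toC x.
Proof. by apply/CrealP/complex_realP; exists x. Qed.

Lemma char_poly_conj (F : fieldType) n (P D : 'M[F]_n) : P \in unitmx ->
  char_poly (invmx P *m D *m P) = char_poly D.
Proof.
move=> Pu; rewrite /char_poly /char_poly_mx.
have {1}-> : 'X%:M = map_mx polyC (invmx P) *m 'X%:M *m map_mx polyC P.
  by rewrite scalar_mxC -mulmxA -map_mxM mulVmx // map_mx1 mulmx1.
rewrite !map_mxM -mulmxBl -mulmxBr !det_mulmx mulrAC -det_mulmx -map_mxM.
by rewrite mulVmx // map_mx1 det1 mul1r.
Qed.

Lemma spectral_symmetric n (A : 'M[R]_n) : A^T = A ->
  exists (P : 'M[C]_n) (d : 'I_n -> R),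
    [/\ P *m (map_mx Num.conj P^T) = 1%:M,
        map_mx toC A = map_mx Num.conj P^T *m diag_mx (\row_i toC (d i)) *m P
      & char_poly A = \prod_i ('X - (d i)%:P)].
Proof.
move=> symA; set B := map_mx toC A.
have Breal : B \is a realmx.
  by apply/mxOverP => i j; rewrite mxE; apply/complex_realP; eexists.
have Bsym : B \is symmetricmx.
  by apply/is_hermitianmxP; rewrite expr0 scale1r map_mx_id // map_trmx symA.
have Bherm := realsym_hermsym Bsym Breal.
have Dreal := hermitian_spectral_diag_real Bherm.
have /orthomx_spectralP EB := hermitian_normalmx Bherm.
have PU := spectral_unitarymx B.
exists (spectralmx B), (fun i => complex.Re (spectral_diag B 0 i)).
have ED : spectral_diag B = \row_i toC (complex.Re (spectral_diag B 0 i)).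
  by apply/rowP => i; rewrite mxE RRe_real //; apply: (mxOverP Dreal).
split; first exact/unitarymxP.
  by rewrite -invmx_unitary // -ED.
apply: (map_poly_inj (real_complex R)).
rewrite map_char_poly rmorph_prod /=.
rewrite -/B {1}EB char_poly_conj ?spectral_unit //.
rewrite char_poly_trig ?diag_mx_is_trig //.
apply: eq_bigr => i _; rewrite !mxE eqxx mulr1n rmorphB /= map_polyX map_polyC /=.
by rewrite [in LHS]ED mxE.
Qed.

(** A test plane for the second eigenvalue.  Some nonzero complex combination
    [z = a u + b v] is orthogonal to the only eigenvector whose eigenvalue may
    exceed the second one, and the conclusion is the resulting inequality
    [<z, A z> <= lambda_2 * <z, z>], where [p = |a|^2], [q = |b|^2] and
    [s = Re (a * conj b)].  The coefficients have to be complex because the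
    eigenvectors come from the unitary diagonalisation of [A]. *)
Lemma second_eigenvalue_le n (A : 'M[R]_n) (u v : 'rV[R]_n) :
  A^T = A ->
  let B x y := (x *m A *m y^T) 0 0 in
  let N x y := (x *m y^T) 0 0 in
  exists p q s : R,
    [/\ 0 <= p, 0 <= q, 0 < p + q, s ^+ 2 <= p * q &
        p * B u u + q * B v v + 2 * s * B u v
          <= (eigenvalues A)`_1 * (p * N u u + q * N v v + 2 * s * N u v)].
Proof.
move=> symA B N; set l := (eigenvalues A)`_1.
have [P [d [PU EA Echar]]] := spectral_symmetric symA.
(* [i0] is the index of the simple top eigenvalue, and [None] when no eigenvalue
   exceeds the second one. *)
have [i0 di0] : exists i0 : option 'I_n, forall i, Some i != i0 -> d i <= l.
  have cnt : (#|[pred i | (l < d i)%R]| <= 1)%N.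
    rewrite -sum1_card -(big_map d (fun x => l < x) (fun=> 1%N)) sum1_count.
    have Eperm : perm_eq (eigenvalues A) [seq d i | i <- index_enum 'I_n].
      by apply: perm_eigenvalues; rewrite Echar big_map.
    by rewrite -(permP Eperm) count_gt_second // sorted_eigenvalues.
  case: (pickP [pred i | (l < d i)%R]) => [i /= li|no]; last first.
    by exists None => i _; rewrite leNgt; have /= -> := no i.
  exists (Some i) => j ji; rewrite leNgt; apply/negP => lj.
  move/card_le1_eqP: cnt => /(_ i j); rewrite !inE => /(_ li lj) ij.
  by rewrite ij eqxx in ji.
(* The coordinates in the eigenbasis. *)
pose w (x : 'rV[R]_n) : 'rV[C]_n := map_mx toC x *m map_mx Num.conj P^T.
have wP x i : (P *m (map_mx toC x)^T) i 0 = Num.conj (w x 0 i).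
  rewrite !mxE rmorph_sum; apply: eq_bigr => j _.
  by rewrite !mxE rmorphM /= conjC_toC conjCK mulrC.
have BE x y : toC (B x y) = \sum_i toC (d i) * (w x 0 i * Num.conj (w y 0 i)).
  have -> : toC (B x y) = (map_mx toC (x *m A *m y^T)) 0 0 by rewrite mxE.
  rewrite !map_mxM EA !mulmxA -(mulmxA _ P) -(map_trmx _ y) mxE; apply: eq_bigr => i _.
  by rewrite wP mul_mx_diag [X in X * _]mxE [X in _ * X * _]mxE mulrAC mulrC.
have NE x y : toC (N x y) = \sum_i (w x 0 i * Num.conj (w y 0 i)).
  have -> : toC (N x y) = (map_mx toC (x *m y^T)) 0 0 by rewrite mxE.
  have Pu : map_mx Num.conj P^T *m P = 1%:M by apply: mulmx1C.
  rewrite map_mxM -[map_mx _ x]mulmx1 -Pu mulmxA -mulmxA -(map_trmx _ y) mxE.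
  by apply: eq_bigr => i _; rewrite wP.
have Bsym : B v u = B u v.
  rewrite /B -[in LHS](trmxK (v *m A *m u^T)) mxE.
  by rewrite !trmx_mul trmxK symA mulmxA.
have Nsym : N v u = N u v by rewrite /N -[in LHS](trmxK (v *m u^T)) mxE trmx_mul trmxK.
have [a [b [nzab zi0]]] : exists a b : C, (a != 0) || (b != 0) /\
    forall i, Some i = i0 -> a * w u 0 i + b * w v 0 i = 0.
  case: i0 {di0} => [i|]; last by exists 1, 0; rewrite oner_eq0.
  have [wu0|wu0] := eqVneq (w u 0 i) 0.
    by exists 1, 0; rewrite oner_eq0; split=> // _ [->]; rewrite wu0; ring.
  exists (- w v 0 i), (w u 0 i); rewrite wu0 orbT; split=> // _ [->]; ring.
have [p Ep] : exists p, `|a| ^+ 2 = toC p.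
  by apply/complex_realP; rewrite rpredX // normr_real.
have [q Eq] : exists q, `|b| ^+ 2 = toC q.
  by apply/complex_realP; rewrite rpredX // normr_real.
have [s Es] : exists s, 'Re (a * Num.conj b) = toC s.
  by apply/complex_realP; rewrite Creal_Re.
have p0 : 0 <= p by rewrite -lecR -Ep exprn_ge0.
have q0 : 0 <= q by rewrite -lecR -Eq exprn_ge0.
exists p, q, s; split=> //.
- rewrite lt0r addr_ge0 // andbT paddr_eq0 // negb_and.
  by move: nzab; rewrite -!(inj_eq (@complexI R)) -Ep -Eq !expf_eq0 !normr_eq0.
- rewrite -lecR rmorphXn rmorphM /= -Ep -Eq -Es -exprMn.
  rewrite -(norm_conjC b) -normrM normC2_Re_Im lerDl.
  by rewrite real_exprn_even_ge0 // Creal_Im.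
have E2s : toC (2 * s) = a * Num.conj b + Num.conj a * b.
  by rewrite rmorphM /= -Es ReE rmorphM /= conjCK rmorph_nat mulrC divfK //.
have quad (c : 'I_n -> R) (F : 'rV[R]_n -> 'rV[R]_n -> R) :
    (forall x y, toC (F x y) = \sum_i toC (c i) * (w x 0 i * Num.conj (w y 0 i))) ->
    F v u = F u v ->
    toC (p * F u u + q * F v v + 2 * s * F u v)
    = \sum_i toC (c i) * `|a * w u 0 i + b * w v 0 i| ^+ 2.
  move=> FE Fsym.
  transitivity (toC p * toC (F u u) + toC q * toC (F v v) + toC (2 * s) * toC (F u v)).
    by rewrite -!rmorphM -!rmorphD.
  rewrite E2s -Ep -Eq !normCK.
  rewrite mulrDl -[in X in _ + (_ + X)]Fsym !FE !big_distrr /= -!big_split /=.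
  apply: eq_bigr => i _; rewrite normCK rmorphD 2!rmorphM /=; ring.
rewrite -lecR rmorphM /= (quad d B) // (quad (fun=> 1) N) //; last first.
  by move=> x y; rewrite NE; apply: eq_bigr => i _; rewrite mul1r.
rewrite big_distrr /=; apply: ler_sum => i _; rewrite mul1r.
have [/zi0->|ne] := eqVneq (Some i) i0; first by rewrite normr0 expr0n !mulr0.
by rewrite ler_wpM2r ?exprn_ge0 // lecR di0.
Qed.
End Spectral.

(** * Positive supersolutions of nonnegative kernels *)

Lemma psumr_sqr_eq0 (R : realDomainType) (V : finType) (f : V -> R) :
  \sum_x f x ^+ 2 <= 0 -> forall x, f x = 0.
Proof.
move=> le0 x; have ge0 y : true -> 0 <= f y ^+ 2 by rewrite sqr_ge0.
have /eqP : \sum_x f x ^+ 2 = 0 by apply/eqP; rewrite eq_le le0 sumr_ge0.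
by rewrite psumr_eq0 // => /allP/(_ x (mem_index_enum x)) /=; rewrite expf_eq0 => /eqP.
Qed.

Lemma sum_enum_val (R : zmodType) (V : finType) (F : V -> R) :
  \sum_(i < #|V|) F (enum_val i) = \sum_x F x.
Proof. by rewrite [RHS](reindex _ (onW_bij _ (@enum_val_bij V))). Qed.

Section Supersolution.
Variables (R : realFieldType) (V : finType) (K : V -> V -> R) (c0 c : R).
Hypothesis K_ge0 : forall x y, 0 <= K x y.
Hypothesis K_sym : forall x y, K x y = K y x.
Hypothesis K_le : forall f : V -> R,
  \sum_x \sum_y K x y * (f x * f y) <= c0 * \sum_x f x ^+ 2.
Hypothesis c0_ge0 : 0 <= c0.
Hypothesis c0_lt_c : c0 < c.

(** The matrix [c - K] is invertible because it is positive definite. *)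
Lemma resolvent_exists : exists g : V -> R,
  forall x, c * g x = 1 + \sum_y K x y * g y.
Proof.
pose M : 'M[R]_#|V| := c%:M - \matrix_(i, j) K (enum_val i) (enum_val j).
have ME (w : 'rV[R]_#|V|) x : (w *m M) 0 (enum_rank x) =
    c * w 0 (enum_rank x) - \sum_y K x y * w 0 (enum_rank y).
  rewrite mulmxBr mul_mx_scalar 3!mxE; congr (_ - _).
  rewrite -(sum_enum_val (fun y => K x y * w 0 (enum_rank y))).
  by rewrite mxE; apply: eq_bigr => i _; rewrite mxE enum_rankK enum_valK K_sym mulrC.
have Mu : M \in unitmx.
  rewrite -row_free_unit -kermx_eq0; apply/eqP/row_matrixP => i; rewrite row0.
  set w := row i _; have wM : w *m M = 0 by rewrite -row_mul mulmx_ker row0.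
  suff w0 x : w 0 (enum_rank x) = 0.
    by apply/rowP => j; rewrite -[j]enum_valK w0 mxE.
  move: x; apply: (@psumr_sqr_eq0 _ _ (fun x => w 0 (enum_rank x))).
  pose f x := w 0 (enum_rank x); rewrite -/(f _).
  suff E : c * \sum_x f x ^+ 2 = \sum_x \sum_y K x y * (f x * f y).
    by have := K_le f; rewrite -E -subr_ge0 -mulrBl nmulr_rge0 // subr_lt0.
  rewrite big_distrr; apply: eq_bigr => x _ /=.
  have /eqP : (w *m M) 0 (enum_rank x) = 0 by rewrite wM mxE.
  rewrite ME subr_eq0 => /eqP Ex; rewrite expr2 mulrCA -/(f x) in Ex *.
  by rewrite Ex big_distrr; apply: eq_bigr => y _ /=; rewrite mulrCA.
pose g : 'rV[R]_#|V| := const_mx 1 *m invmx M.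
exists (fun x => g 0 (enum_rank x)) => x; apply/eqP; rewrite -subr_eq -ME.
by rewrite mulmxKV // mxE.
Qed.

(** Testing [(c - K) g = 1] against the negative part [h] of [g] gives
    [0 <= sum h <= <h, K h> - c <h, h> <= (c0 - c) <h, h>], hence [h = 0];
    positivity then follows from [c g = 1 + K g >= 1]. *)
Lemma positive_supersolution : exists2 g : V -> R,
  forall x, 0 < g x & forall x, \sum_y K x y * g y <= c * g x.
Proof.
have [g gE] := resolvent_exists.
have c_gt0 : 0 < c := le_lt_trans c0_ge0 c0_lt_c.
pose h x := Num.max (- g x) 0.
have h_ge0 x : 0 <= h x by rewrite le_max lexx orbT.
have hg x : h x * g x = - (h x ^+ 2).
  by rewrite /h; case: (leP (- g x) 0) => _; ring.
have gh y : - g y <= h y by rewrite le_max lexx.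
have h0 : forall x, h x = 0.
  apply: psumr_sqr_eq0.
  have sum_h : 0 <= \sum_x h x by apply: sumr_ge0.
  have le_hKh : \sum_x h x <= \sum_x \sum_y K x y * (h x * h y) - c * \sum_x h x ^+ 2.
    rewrite big_distrr /= -sumrB; apply: ler_sum => x _.
    have Eh : h x = c * (h x * g x) + \sum_y K x y * (h x * - g y).
      rewrite mulrCA gE mulrDr mulr1 -addrA big_distrr /= -big_split /=.
      by rewrite big1 ?addr0 // => y _; ring.
    rewrite [leLHS]Eh hg mulrN addrC lerD2r; apply: ler_sum => y _.
    by rewrite !ler_wpM2l.
  have := K_le h; set S := \sum_x h x ^+ 2 in le_hKh * => leS.
  by rewrite -(pmulr_rle0 _ (x := c - c0)) ?subr_gt0 // mulrBl; lra.
have g_ge0 x : 0 <= g x by rewrite -oppr_le0 -(h0 x).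
exists g => x; last by rewrite gE lerDr.
rewrite -(pmulr_rgt0 _ c_gt0) gE ltr_wpDr // sumr_ge0 // => y _.
by rewrite mulr_ge0.
Qed.
End Supersolution.

(** * Supersolutions of Toeplitz kernels on an interval *)

(** The shift from [p.1] to [p.2] is [2 i - r], of absolute value at most [r],
    so at most [r] points of the interval are moved out of it. *)
Lemma card_shift_pairs (n r i : nat) : (i <= r)%N ->
  (n - r <= #|[set p : 'I_n * 'I_n | (p.2 + r == p.1 + i.*2)%N]|)%N.
Proof.
move=> ir; set S := [set _ | _].
have lt1 (j : 'I_(n - r)) : (j + (r - i.*2) < n)%N by case: j => j /= ?; lia.
have lt2 (j : 'I_(n - r)) : (j + (i.*2 - r) < n)%N by case: j => j /= ?; lia.
(* One of the two truncated differences vanishes; the other one is the shift. *)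
pose h j : 'I_n * 'I_n := (Ordinal (lt1 j), Ordinal (lt2 j)).
have h_inj : injective h.
  by move=> j k /(congr1 (fun p => val p.1)) /= E; apply: val_inj => /=; lia.
rewrite -{1}(card_ord (n - r)) -(card_imset _ h_inj).
by apply/subset_leq_card/fintype.subsetP => _ /imsetP[j _ ->]; rewrite inE /=; lia.
Qed.

Lemma AMGM_ratio (R : rcfType) (a b t : R) : 0 <= a -> 0 <= b -> 0 < t ->
  2 * Num.sqrt (a * b) <= a * t + b * t^-1.
Proof.
move=> a0 b0 t0; have ti0 : 0 <= t^-1 by rewrite invr_ge0 ltW.
have at0 : 0 <= a * t by rewrite mulr_ge0 // ltW.
have bt0 : 0 <= b * t^-1 by rewrite mulr_ge0.
have -> : a * b = (a * t) * (b * t^-1) by rewrite mulrACA divff ?mulr1 ?gt_eqF.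
rewrite sqrtrM // -{2}(sqr_sqrtr at0) -{2}(sqr_sqrtr bt0).
move: (Num.sqrt _) (Num.sqrt _) => x y; have := sqr_ge0 (x - y); nra.
Qed.

Section Toeplitz.
Variables (R : rcfType) (n r : nat) (a f : nat -> R) (c : R).
Hypothesis a_ge0 : forall i, 0 <= a i.
Hypothesis f_gt0 : forall h, (h < n)%N -> 0 < f h.
Hypothesis f_super : forall h, (h < n)%N ->
  \sum_(i < r.+1) \sum_(k < n | (k + r == h + i.*2)%N) a i * f k <= c * f h.

(** Divide the supersolution inequality by [f h] and add to each jump its
    reverse: [f] cancels in
    [a_i f_k / f_h + a_(r-i) f_h / f_k >= 2 sqrt (a_i a_(r-i))], which leaves a
    bound on the geometric symmetrisation of the Toeplitz kernel [a]. *)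
Lemma toeplitz_supersolution :
  (n - r)%:R * (\sum_(i < r.+1) Num.sqrt (a i * a (r - i)%N)) <= c * n%:R.
Proof.
pose chi (h : 'I_n) (k : 'I_n) (i : 'I_r.+1) : R := (k + r == h + i.*2)%N%:R.
pose S := \sum_(h < n) \sum_(k < n) \sum_(i < r.+1) chi h k i * (a i * (f k / f h)).
have S_le : S <= c * n%:R.
  rewrite mulr_natr -[X in _ *+ X]card_ord -sumr_const; apply: ler_sum => h _.
  rewrite exchange_big -(ler_pM2r (f_gt0 (ltn_ord h))).
  apply: le_trans (f_super (ltn_ord h)); rewrite mulr_suml.
  apply: ler_sum => i _; rewrite mulr_suml [leRHS]big_mkcond.
  apply: ler_sum => k _; rewrite /chi /=; case: ifP => _; last by rewrite !mul0r.
  by rewrite mul1r -mulrA divfK // gt_eqF ?f_gt0.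
(* The jump from [k] to [h] that reverses a jump of type [i] has type [r - i]. *)
have S_rev : S = \sum_(h < n) \sum_(k < n) \sum_(i < r.+1)
    chi h k i * (a (r - i)%N * (f k / f h)^-1).
  rewrite /S exchange_big; apply: eq_bigr => h _; apply: eq_bigr => k _.
  rewrite (reindex_inj rev_ord_inj); apply: eq_bigr => i _ /=.
  rewrite /chi /= subSS invf_div; congr (_%:R * _); have := ltn_ord i; lia.
suff: (n - r)%:R * (\sum_(i < r.+1) Num.sqrt (a i * a (r - i)%N)) <= S by move/le_trans; apply.
have : 2 * \sum_(h < n) \sum_(k < n) \sum_(i < r.+1)
    chi h k i * Num.sqrt (a i * a (r - i)%N) <= S + S.
  rewrite {2}S_rev -big_split mulr_sumr; apply: ler_sum => h _.
  rewrite -big_split mulr_sumr; apply: ler_sum => k _.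
  rewrite -big_split mulr_sumr; apply: ler_sum => i _ /=.
  rewrite mulrCA -mulrDr ler_wpM2l ?ler0n //.
  by apply: AMGM_ratio; rewrite // divr_gt0 ?f_gt0.
rewrite -mulr2n -[in leRHS]mulr_natl ler_pM2l //; apply: le_trans.
under [leRHS]eq_bigr do rewrite exchange_big.
rewrite exchange_big mulr_sumr; apply: ler_sum => i _.
rewrite pair_big /= -mulr_suml ler_wpM2r ?sqrtr_ge0 //.
apply: le_trans (_ : #|[set p : 'I_n * 'I_n | (p.2 + r == p.1 + i.*2)%N]|%:R <= _).
  by rewrite ler_nat card_shift_pairs // -ltnS.
by rewrite -sum1_card natr_sum big_mkcond; apply: ler_sum => p _; rewrite inE /chi; case: ifP.
Qed.
End Toeplitz.

(** * Walks and distances *)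

Section Walks.
Local Open Scope nat_scope.
Variable G : graph.
Implicit Types (x y z : G) (i j k : nat).

Lemma has_walk0 x y : has_walk 0 x y = (x == y).
Proof.
apply/existsP/eqP => [[p]|->]; first by rewrite tuple0 => /eqP.
by exists [tuple] => /=.
Qed.

Lemma has_walkS k x y : has_walk k.+1 x y <-> exists2 z, adj x z & has_walk k z y.
Proof.
split=> [/existsP[p]|[z xz /existsP[p /andP[zp py]]]].
  case/tupleP: p => z p /= /andP[/andP[xz zp] py]; exists z => //.
  by apply/existsP; exists p; rewrite zp.
by apply/existsP; exists [tuple of z :: p]; rewrite /= xz zp.
Qed.

Lemma has_walk_cat i j x y z : has_walk i x y -> has_walk j y z -> has_walk (i + j) x z.
Proof.
elim: i x => [|i IH] x; first by rewrite has_walk0 => /eqP->.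
move=> /has_walkS[t xt ty] yz; rewrite addSn.
by apply/has_walkS; exists t => //; apply: IH ty yz.
Qed.

Lemma walk_function k x y : has_walk k x y -> exists w : nat -> G,
  [/\ w 0%N = x, w k = y & forall j, (j < k)%N -> adj (w j) (w j.+1)].
Proof.
elim: k x => [|k IH] x.
  by rewrite has_walk0 => /eqP <-; exists (fun=> x).
move=> /has_walkS[z xz /IH[w [w0 wk wadj]]].
exists (fun j => if j is j'.+1 then w j' else x); split=> // -[|j] /=; last exact: wadj.
by rewrite w0.
Qed.

Lemma has_walk_segment (w : nat -> G) a i :
  (forall j, (a <= j < a + i)%N -> adj (w j) (w j.+1)) -> has_walk i (w a) (w (a + i)%N).
Proof.
elim: i a => [|i IH] a wadj; first by rewrite has_walk0 addn0.
apply/has_walkS; exists (w a.+1); first by apply: wadj; lia.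
by rewrite addnS -addSn; apply: IH => j jb; apply: wadj; lia.
Qed.

Lemma gdist_le_walk k x y : has_walk k x y -> (gdist x y <= k)%N.
Proof.
move=> xy; rewrite leqNgt; apply/negP => lt.
have := before_find 0%N lt; rewrite nth_iota ?add0n ?xy //.
by apply: leq_trans lt _; rewrite -[leqRHS](size_iota 0) find_size.
Qed.

Hypothesis G_conn : connected_graph G.

Lemma has_walk_gdist x y : has_walk (gdist x y) x y.
Proof.
suff : has (fun k => has_walk k x y) (iota 0 #|G|).
  move=> h; have := nth_find 0%N h; rewrite nth_iota //.
  by move: h; rewrite has_find size_iota.
have /connectP[p xp ->] := G_conn x y.
case/shortenP: xp => q xq /card_uniqP /= szq _.
apply/hasP; exists (size q).
  by rewrite mem_iota /= add0n -szq max_card.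
by apply/existsP; exists (in_tuple q); rewrite xq /=.
Qed.

Lemma gdist_triangle y x z : (gdist x z <= gdist x y + gdist y z)%N.
Proof. by apply/gdist_le_walk/(@has_walk_cat _ _ _ y); apply: has_walk_gdist. Qed.

Lemma delta_le i x y : adj x y ->
  (delta G i <= #|[set v | (gdist x v == i) && (i <= gdist y v)%N]|)%N.
Proof.
move=> xy; rewrite /delta; have := mem_index_enum (x, y).
elim: (index_enum _) => //= e s IH; rewrite inE big_cons => /predU1P[<-|/IH le] /=.
  by rewrite xy geq_minl.
by case: ifP => // _; rewrite geq_min le orbT.
Qed.

(** If [i < j], going from [w (h + j)] back along the walk to [w (h + i).+1] and
    then to [y] takes only [(j - i - 1) + i < j] steps.  This is the purpose of
    the condition on the second vertex in the definition of [delta]. *)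
Lemma branch_index_unique h k (w : nat -> G) (y : G) (i j : nat) :
  (forall m, (m < k)%N -> adj (w m) (w m.+1)) -> (h + i <= k)%N -> (h + j <= k)%N ->
  gdist (w (h + i).+1) y = i -> (i <= gdist (w (h + i)) y)%N ->
  gdist (w (h + j).+1) y = j -> (j <= gdist (w (h + j)) y)%N -> (i = j)%N.
Proof.
move=> wadj.
wlog ij : i j / (i < j)%N => [W|] hik hjk di ge_i dj ge_j.
  by case: (ltngtP i j) => [lt|lt|//]; [|symmetry]; apply: (W _ _ lt).
have : has_walk (j - i).-1 (w (h + i).+1) (w (h + j)).
  have -> : (h + j = (h + i).+1 + (j - i).-1)%N by lia.
  by apply: has_walk_segment => m mb; apply: wadj; lia.
rewrite has_walk_sym => /gdist_le_walk le1.
by have := gdist_triangle (w (h + i).+1) (w (h + j)) y; lia.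
Qed.
End Walks.

(** * The local bound on a ball *)

Section Local.
Variables (R : realType) (G : graph) (u : G) (L r : nat).
Hypothesis G_conn : connected_graph G.
Hypothesis u_edge : exists v, adj u v.

Definition ball_kernel (x y : G) : R :=
  [&& gdist u x <= L, gdist u y <= L & gdist x y <= r]%N%:R.

(** Walks of all lengths exist because one can go back and forth on an edge. *)
Lemma has_walk_from k : exists v, has_walk k u v.
Proof.
have [v uv] := u_edge.
exists (if odd k then v else u).
pose w j := if odd j then v else u.
apply: (has_walk_segment (w := w) (a := 0)) => j _.
by rewrite /w /=; case: (odd j); rewrite // adj_sym.
Qed.

(** The walk to [v] is cut at its vertex [X i] of index [(h + i).+1], so [r - i]
    steps are removed, and [Y i] is the vertex before [X i]; it exists because
    the walk has more than [r] steps. *)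
Lemma branch_sum_le (g : G -> R) (h : nat) (v : G) : (forall y, 0 <= g y) ->
  has_walk (r.+1 + h)%N u v -> (r.+1 + h <= L)%N ->
  exists X Y : 'I_r.+1 -> G, [/\ forall i, adj (X i) (Y i),
    forall i : 'I_r.+1, has_walk (h + i)%N.+1 u (X i) &
    \sum_(i < r.+1) \sum_(y | [&& gdist (X i) y == i, i <= gdist (Y i) y
        & gdist u y <= L]%N) g y <= \sum_y ball_kernel v y * g y].
Proof.
move=> g_ge0 uv hL; have [w [w0 wk wadj]] := walk_function uv.
exists (fun i => w (h + i)%N.+1), (fun i => w (h + i)%N).
have lti (i : 'I_r.+1) : (h + i < r.+1 + h)%N by have := ltn_ord i; lia.
have seg (i : 'I_r.+1) : has_walk (r - i) (w (h + i)%N.+1) v.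
  have -> : v = w ((h + i)%N.+1 + (r - i))%N.
    by rewrite -wk; congr w; have := ltn_ord i; lia.
  by apply: has_walk_segment => j jb; apply: wadj; have := ltn_ord i; lia.
split=> [i|i|]; first by rewrite adj_sym wadj.
  by rewrite -w0; apply: (has_walk_segment (a := 0)) => j jb; apply: wadj; have := lti i; lia.
under eq_bigr do rewrite big_mkcond.
rewrite exchange_big; apply: ler_sum => y _ /=; rewrite -big_mkcond /=.
case: (pickP (fun i : 'I_r.+1 => [&& gdist (w (h + i)%N.+1) y == i,
    i <= gdist (w (h + i)%N) y & gdist u y <= L]%N)) => [i0 /and3P[/eqP d0 ge0 uy]|no]; last first.
  by rewrite big_pred0 ?mulr_ge0 ?ler0n.
rewrite (bigD1 i0) /=; last by rewrite d0 eqxx ge0.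
rewrite big_pred0 => [|i]; last first.
  apply/negP => /andP[/and3P[/eqP di gei _] /negP[]]; apply/eqP/val_inj.
  by apply: (branch_index_unique G_conn wadj _ _ di gei d0 ge0); apply: ltnW; apply: lti.
have uvL : (gdist u v <= L)%N := leq_trans (gdist_le_walk uv) hL.
have vy : (gdist v y <= r)%N.
  apply: leq_trans (gdist_triangle G_conn (w (h + i0)%N.+1) v y) _.
  rewrite gdist_sym d0; have := gdist_le_walk (seg i0); have := ltn_ord i0; lia.
by rewrite addr0 /ball_kernel uvL uy vy mul1r.
Qed.

(** The window of walk lengths is [r + 1, ..., L], shifted to [0, ..., L - r - 1];
    its upper end keeps the walks inside the ball. *)
Lemma ball_bound (c0 : R) : 0 <= c0 ->
  (forall f : G -> R, (forall x, (L < gdist u x)%N -> f x = 0) ->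
    \sum_x \sum_y (power_adj r x y)%:R * (f x * f y) <= c0 * \sum_x f x ^+ 2) ->
  (L - r - r)%:R * (\sum_(i < r.+1) Num.sqrt ((delta G i)%:R * (delta G (r - i))%:R))
    <= c0 * (L - r)%:R.
Proof.
move=> c0_ge0 c0P.
have K_ge0 x y : 0 <= ball_kernel x y by rewrite ler0n.
have K_sym x y : ball_kernel x y = ball_kernel y x.
  by rewrite /ball_kernel gdist_sym (gdist_sym x y) andbCA.
have K_le f : \sum_x \sum_y ball_kernel x y * (f x * f y) <= c0 * \sum_x f x ^+ 2.
  pose f' x := if (gdist u x <= L)%N then f x else 0.
  apply: le_trans (_ : c0 * \sum_x f' x ^+ 2 <= _); last first.
    rewrite ler_wpM2l //; apply: ler_sum => x _; rewrite /f'.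
    by case: ifP => // _; rewrite expr0n sqr_ge0.
  apply: le_trans (c0P f' _); last by move=> x; rewrite /f' ltnNge => /negPf->.
  apply: ler_sum => x _; apply: ler_sum => y _; rewrite /ball_kernel /f' /power_adj.
  by move: (gdist u x <= L)%N (gdist u y <= L)%N => [] [] /=; rewrite ?(mul0r, mulr0).
have bound c : c0 < c -> (L - r - r)%:R *
  (\sum_(i < r.+1) Num.sqrt ((delta G i)%:R * (delta G (r - i))%:R)) <= c * (L - r)%:R.
  move=> c0c; have [g g_gt0 Kg] := positive_supersolution K_ge0 K_sym K_le c0_ge0 c0c.
  (* [m h] minimises [g] over the ends of the walks of length [r.+1 + h]. *)
  have min_end h : exists2 v, has_walk (r.+1 + h)%N u v &
      forall y, has_walk (r.+1 + h)%N u y -> g v <= g y.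
    have [v uv] := has_walk_from (r.+1 + h)%N.
    by case: (arg_minP g uv) => v' uv' min; exists v'.
  have [m m_walk m_min] : exists2 m : nat -> G, forall h, has_walk (r.+1 + h)%N u (m h) &
      forall h y, has_walk (r.+1 + h)%N u y -> g (m h) <= g y.
    have /choice[m mP] : forall h, exists v, has_walk (r.+1 + h)%N u v /\
      forall y, has_walk (r.+1 + h)%N u y -> g v <= g y.
      by move=> h; have [v ? ?] := min_end h; exists v.
    by exists m => h; have [] := mP h.
  apply: (toeplitz_supersolution (a := fun i => (delta G i)%:R) (f := g \o m)) => [i|h _|h hL] /=.
  - exact: ler0n.
  - exact: g_gt0.
  have [|X [Y [XY uX]]] := branch_sum_le (fun y => ltW (g_gt0 y)) (m_walk h); first by lia.
  move=> le; apply: le_trans (le_trans le (Kg _)); apply: ler_sum => i _.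
  case: (pickP (fun k : 'I_(L - r) => k + r == h + i.*2)%N) => [k /eqP Ek|no]; last first.
    by rewrite big_pred0 // sumr_ge0 // => y _; apply/ltW/g_gt0.
  rewrite (big_pred1 k) => [|k']; last first.
    by rewrite -Ek eqn_add2r.
  apply: le_trans (_ : #|[set y | (gdist (X i) y == i) && (i <= gdist (Y i) y)%N]|%:R
      * g (m k) <= _).
    by rewrite ler_wpM2r ?ler_nat ?delta_le // ltW.
  rewrite -sum1_card natr_sum mulr_suml.
  rewrite big_mkcond [leRHS]big_mkcond; apply: ler_sum => y _; rewrite inE mul1r.
  case: ifP => [/andP[/eqP d ge]|_]; last by case: ifP => // _; apply/ltW.
  have uy : has_walk (r.+1 + k)%N u y.
    have -> : (r.+1 + k = (h + i).+1 + gdist (X i) y)%N by lia.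
    exact: has_walk_cat (uX i) (has_walk_gdist G_conn _ _).
  have uyL : (gdist u y <= L)%N.
    by apply: leq_trans (gdist_le_walk uy) _; have := ltn_ord k; lia.
  by rewrite d eqxx ge uyL m_min.
apply/ler_addgt0Pr => e e0; set n := (L - r)%N in bound *.
have n1_gt0 : 0 < n.+1%:R :> R by rewrite ltr0n.
apply: le_trans (bound (c0 + e / n.+1%:R) _) _; first by rewrite ltrDl divr_gt0.
rewrite mulrDl lerD2l mulrAC ler_pdivrMr // ler_pM2l // ler_nat; lia.
Qed.
End Local.

(** * The second eigenvalue of a power graph *)

Section Lambda2.
Variable R : realType.

Definition adj_form (H : graph) (f g : H -> R) : R :=
  \sum_x \sum_y (adj x y)%:R * (f x * g y).

Lemma lambda2_test (H : graph) (f g : H -> R) : exists p q s : R,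
  [/\ 0 <= p, 0 <= q, 0 < p + q, s ^+ 2 <= p * q &
      p * adj_form f f + q * adj_form g g + 2 * s * adj_form f g
        <= lambda R 2 H * (p * (\sum_x f x ^+ 2) + q * (\sum_x g x ^+ 2)
                           + 2 * s * \sum_x f x * g x)].
Proof.
pose A := adj_matrix R H; pose row_of (h : H -> R) := \row_(i < #|H|) h (enum_val i).
have symA : A^T = A by apply/matrixP => i j; rewrite !mxE adj_sym.
have [p [q [s]]] := second_eigenvalue_le (row_of f) (row_of g) symA.
have BE h k : (row_of h *m A *m (row_of k)^T) 0 0 = adj_form h k.
  rewrite /adj_form exchange_big -sum_enum_val mxE; apply: eq_bigr => j _ /=.
  rewrite -sum_enum_val !mxE mulr_suml; apply: eq_bigr => i _.
  by rewrite !mxE mulrAC mulrC.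
have NE h k : (row_of h *m (row_of k)^T) 0 0 = \sum_x h x * k x.
  by rewrite -sum_enum_val mxE; apply: eq_bigr => j _; rewrite !mxE.
by rewrite !BE !NE => ?; exists p, q, s.
Qed.

Variables (G : graph) (r : nat).
Hypothesis G_conn : connected_graph G.
Local Notation D := (diam G).
Local Notation l := (lambda R 2 (power_graph G r)).

Lemma diam_attained : (0 < D)%N -> exists a b : G, gdist a b = D.
Proof.
move=> D_gt0; have G_gt0 : (0 < #|G|)%N.
  rewrite lt0n; apply/negP => /eqP/card0_eq G0.
  by move: D_gt0; rewrite /diam big_pred0.
have [a Ea] := bigop.eq_bigmax (fun x : G => \max_(y : G) gdist x y) G_gt0.
have [b Eb] := bigop.eq_bigmax (fun y : G => gdist a y) G_gt0.
by exists a, b; rewrite /diam Ea Eb.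
Qed.

Lemma gdist_refl (x : G) : gdist x x = 0%N.
Proof. by apply/eqP; rewrite -leqn0 gdist_le_walk // has_walk0. Qed.

Lemma sum_indicator (a : G) (F : G -> R) : \sum_x (x == a)%:R * F x = F a.
Proof.
rewrite (bigD1 a) //= eqxx mul1r big1 ?addr0 // => x /negPf->.
by rewrite mul0r.
Qed.

(** On the span of two distinct vertices the form has matrix [[1, e], [e, 1]]
    with [e] equal to 0 or 1, which is positive semidefinite. *)
Lemma lambda2_ge0 : (0 < D)%N -> 0 <= l.
Proof.
move=> D_gt0; have [a [b ab]] := diam_attained D_gt0.
have neq_ab : a != b by apply: contraTneq D_gt0 => Eab; rewrite -ab Eab gdist_refl.
pose e (c : G) (x : G) : R := (x == c)%:R.
have eE c d : adj_form (H := power_graph G r) (e c) (e d) = (power_adj r c d)%:R.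
  rewrite /adj_form -(sum_indicator c (fun x => (power_adj r x d)%:R)); apply: eq_bigr => x _ /=.
  rewrite -(sum_indicator d (fun y => (@power_adj G r x y)%:R)) mulr_sumr; apply: eq_bigr => y _.
  by rewrite /= /e; ring.
have e2 c : \sum_(x : G) e c x ^+ 2 = 1.
  by rewrite -[RHS](sum_indicator c (fun=> 1)); apply: eq_bigr => x _; rewrite /e; case: eqP => _ /=; ring.
have eab : \sum_(x : G) e a x * e b x = 0 by rewrite (sum_indicator a) /e (negPf neq_ab).
have [p [q [s]]] := @lambda2_test (power_graph G r) (e a) (e b).
rewrite !eE !e2 eab /power_adj !gdist_refl /= !mulr1 mulr0 addr0.
move=> [p0 q0 pq0 s_le le_l]; rewrite -(pmulr_lge0 _ pq0); apply: le_trans le_l.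
have : s ^+ 2 * 4 <= (p + q) ^+ 2 by have := sqr_ge0 (p - q); nra.
case: (gdist a b <= r)%N; last by move=> _; rewrite mulr0 addr0 ltW.
rewrite mulr1 => le4; rewrite leNgt; apply/negP => lt0; clear - pq0 le4 lt0; nra.
Qed.

Local Notation S :=
  (\sum_(i < r.+1) Num.sqrt ((delta G i)%:R * (delta G (r - i))%:R : R)).

(** If the bound failed, the local bound would give on each of the two balls a
    function whose Rayleigh quotient exceeds [l]; the two functions are
    orthogonal for both forms, so every combination of them would have Rayleigh
    quotient greater than [l], against [lambda2_test]. *)
Lemma lambda2_two_balls (L : nat) : (0 < D)%N -> (r + L + L < D)%N ->
  (L - r - r)%:R * S <= l * (L - r)%:R.
Proof.
move=> D_gt0 LD; have [a [b ab]] := diam_attained D_gt0.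
rewrite leNgt; apply/negP => lt_l.
have bump (c : G) : (exists d, adj c d) -> exists2 f : G -> R,
    (forall x, (L < gdist c x)%N -> f x = 0) &
    l * (\sum_(x : G) f x ^+ 2) < adj_form (H := power_graph G r) f f.
  move=> c_edge; apply: contrapT => nof; move: lt_l; apply/negP; rewrite -leNgt.
  apply: (ball_bound G_conn c_edge (lambda2_ge0 D_gt0)) => f f_supp.
  by rewrite leNgt; apply/negP => f_lt; apply: nof; exists f.
have edge (c d : G) : gdist c d = D -> exists d, adj c d.
  move=> cd; have := has_walk_gdist G_conn c d; rewrite cd -(prednK D_gt0).
  by case/has_walkS => z cz _; exists z.
have [f f0 f_lt] := bump a (edge a b ab).
have [g g0 g_lt] : exists2 g : G -> R, (forall x, (L < gdist b x)%N -> g x = 0) &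
    l * (\sum_(x : G) g x ^+ 2) < adj_form (H := power_graph G r) g g.
  by apply: bump; apply: (edge b a); rewrite gdist_sym.
have far x y : (gdist x y <= r)%N -> f x * g y = 0.
  move=> xy; case: (leqP (gdist a x) L) => [ax|/f0->]; last by rewrite mul0r.
  case: (leqP (gdist b y) L) => [by_|/g0->]; last by rewrite mulr0.
  have := gdist_triangle G_conn x a b; have := gdist_triangle G_conn y x b.
  rewrite ab (gdist_sym y b); lia.
have [p [q [s]]] := @lambda2_test (power_graph G r) f g.
have -> : adj_form (H := power_graph G r) f g = 0.
  rewrite /adj_form big1 // => x _; rewrite big1 // => y _ /=.
  by rewrite /power_adj; case: leqP => [/far->|_]; rewrite ?mulr0 ?mul0r.
have -> : \sum_(x : power_graph G r) f x * g x = 0.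
  by rewrite big1 // => x _; apply: far; rewrite gdist_refl.
rewrite !mulr0 !addr0 => -[p0 q0 pq0 _]; apply/negP; rewrite -ltNge.
rewrite mulrDr mulrCA [l * (q * _)]mulrCA.
move: f_lt g_lt; rewrite /=; move: (adj_form _ _) (adj_form _ _) (l * _) (l * _).
move=> X Y Z W ZX WY; have := ltW ZX; have := ltW WY => WY' ZX'.
have [pp|pp] := ltP 0 p.
  by rewrite ltr_leD ?ltr_pM2l // ler_wpM2l.
have -> : p = 0 by apply/eqP; rewrite eq_le pp p0.
have qq : 0 < q by lra.
by rewrite !mul0r !add0r ltr_pM2l.
Qed.

(** With [2 L >= D - r - 2] and [D > 8 r], the loss [r / (L - r)] in
    [lambda2_two_balls] is at most [8 r / D]. *)
Lemma lambda2_lower_bound : (0 < r)%N -> (8 * r < D)%N ->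
  (1 - 8 * (r%:R / D%:R)) * S <= l.
Proof.
move=> r_gt0 rD; have D_gt0 : (0 < D)%N by lia.
have [L LD LD'] : exists2 L : nat, (r + L + L < D)%N & (D <= r + L + L + 2)%N.
  by exists ((D - r).-1)./2; lia.
have := lambda2_two_balls D_gt0 LD.
have -> : (L - r - r)%:R = (L - r)%:R - r%:R :> R by rewrite natrB //; lia.
have n0 : 0 < (L - r)%:R :> R by rewrite ltr0n; lia.
have D0 : 0 < D%:R :> R by rewrite ltr0n.
rewrite -ler_pdivrMr // mulrAC; apply: le_trans; rewrite ler_wpM2r //.
  by apply: sumr_ge0 => i _; rewrite sqrtr_ge0.
rewrite mulrBl divff ?gt_eqF // lerD2l lerN2 mulrCA ler_wpM2l ?ler0n //.
rewrite ler_pdivlMr // ler_pdivrMl // -natrM ler_nat; lia.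
Qed.

Lemma d_hat_powR : (0 < r)%N -> r.+1%:R * d_hat R r G `^ (r%:R / 2) = S.
Proof.
move=> r_gt0; rewrite /d_hat -powRrM.
have -> : 2 / r%:R * (r%:R / 2) = 1 :> R.
  by field; rewrite pnatr_eq0 -lt0n.
rewrite big_mkord powRr1 ?mulVKf ?pnatr_eq0 // mulr_ge0 ?invr_ge0 ?ler0n //.
by apply: sumr_ge0 => i _; rewrite sqrtr_ge0.
Qed.
End Lambda2.

Local Open Scope classical_set_scope.
Local Open Scope ring_scope.

Theorem theorem2p1 (R : realType) :
  exists2 o : R -> R, o x @[x --> 0^'+] --> (0 : R) &
    forall (G : nat -> graph) (r : nat -> nat) (eps : R),
      (forall n, connected_graph (G n)) ->
      diam (G n) @[n --> \oo] --> \oo ->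
      (forall n, (0 < r n)%N) ->
      (forall n, (r n)%:R = eps * (diam (G n))%:R) ->
      forall n,
        (1 - o eps) * (r n).+1%:R * d_hat R (r n) (G n) `^ ((r n)%:R / 2)
          <= lambda R 2 (power_graph (G n) (r n)).
Proof.
exists (fun x => 8 * x).
  apply: cvg_at_right_filter; rewrite -[X in _ --> X](mulr0 (8 : R)).
  by apply: cvgMr; exact: cvg_id.
move=> G r eps G_conn _ r_gt0 rE n.
rewrite -mulrA d_hat_powR //.
have D_gt0 : (0 < diam (G n))%N.
  rewrite lt0n; apply: contraTneq (r_gt0 n) => D0.
  by rewrite -(ltr0n R) rE D0 mulr0 ltxx.
have epsE : eps = (r n)%:R / (diam (G n))%:R.
  by rewrite rE mulfK // pnatr_eq0 -lt0n.
have [small|large] := ltnP (8 * r n) (diam (G n)).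
  by rewrite epsE; apply: lambda2_lower_bound.
apply: le_trans (lambda2_ge0 R (r n) D_gt0).
apply: mulr_le0_ge0; last by apply: sumr_ge0 => i _; rewrite sqrtr_ge0.
by rewrite subr_le0 epsE mulrA ler_pdivlMr ?ltr0n // mul1r -natrM ler_nat.
Qed.
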